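(* $\mathtt{RealTime_{IA}} = \mathtt{pred}$-$\mathtt{dio}$-$\mathtt{ESO}$-$\mathtt{HORN}$. That is, a language $L\subseteq\Sigma^+$ is accepted in real time by an iterative array (sequential input, neighborhood $\{-1,0,1\}$, first cell as output cell) if and only if $L=\{w\in\Sigma^+:\langle w\rangle\models\Phi\}$ for some predecessor Horn formula with diagonal input-output $\Phi$.
   Context: Fix a finite alphabet $\Sigma$. A nonempty word $w=w_1\cdots w_n\in\Sigma^n$ is represented by the structure $\langle w\rangle=([1,n];(Q_s)_{s\in\Sigma},\mathtt{min},\mathtt{max},\mathtt{suc},\mathtt{pred})$ with domain $[1,n]$, where $Q_s(i)\iff w_i=s$, $\mathtt{min}(i)\iff i=1$, $\mathtt{max}(i)\iff i=n$, $\mathtt{suc}(i)=i+1$ for $i<n$, $\mathtt{suc}(n)=n$, $\mathtt{pred}(i)=i-1$ for $i>1$, $\mathtt{pred}(1)=1$. Write $x-k$ for $\mathtt{pred}^k(x)$. A predecessor Horn formula with diagonal input-output is a formula $\Phi=\exists\mathbf{R}\forall x\forall y\,\psi(x,y)$, $\mathbf{R}$ a finite set of binary relation symbols (computation predicates), $\psi$ a conjunction of Horn clauses in $x,y$ over the signature $\{(Q_s)_{s\in\Sigma},\mathtt{min},\mathtt{max},\mathtt{suc},\mathtt{pred},=\}\cup\mathbf{R}$, each of the form $\delta_1\wedge\cdots\wedge\delta_r\to\delta_0$ with $\delta_0$ an atom $R(x,y)$ ($R\in\mathbf{R}$) or $\bot$, and each hypothesis $\delta_i$ one of: a conjunction $Q_s(x-a)\wedge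 x=y$ ($s\in\Sigma$, integer $a\ge0$); $U(x-a)$, $\neg U(x-a)$, $U(y-a)$, $\neg U(y-a)$ ($U\in\{\mathtt{min},\mathtt{max}\}$, $a\ge0$); $S(x-a,y-b)$ or $S(y-b,x-a)$ ($S\in\mathbf{R}$, $a,b\ge0$). The formula defines $\{w\in\Sigma^+:\langle w\rangle\models\Phi\}$; $\mathtt{pred}$-$\mathtt{dio}$-$\mathtt{ESO}$-$\mathtt{HORN}$ denotes the class of languages so defined. An iterative array is a cellular automaton $(Q,\Sigma,Q_{accept},\mathcal N,\delta)$ (finite $Q\supseteq\Sigma$, $Q_{accept}\subseteq Q$, neighborhood $\mathcal N=\{-1,0,1\}$, $\delta:Q^{3}\to Q$) together with an input transition function $\delta_{input}$, working on cells $1,\dots,n$ for an input $w=w_1\cdots w_n$; cells outside $[1,n]$ are permanently in a state $\sharp$, cells not yet reached by information from the input are in a quiescent state $\lambda$. The input is sequential: the letter $w_i$ is given to cell $1$ at time $i$, i.e. for $t\le n$ the state of cell 1 at time $t$ is computed by $\delta_{input}$ from $w_t$ and the neighbourhood states at time $t-1$, while all other updates are $\langle c,t\rangle=\delta(\langle c+v,t-1\rangle:v\in\mathcal N)$. $\mathtt{RealTime_{IA}}$ is the class of languages $L\subseteq\Sigma^+$ for which such an array exists with $w\in L\iff\langle 1,n\rangle\in Q_{accept}$ for every $w$ of length $n$. *)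

(* Defs.v *)
From Stdlib Require List.
From mathcomp Require Import all_boot.
Set Implicit Arguments.
Unset Strict Implicit.
Unset Printing Implicit Defensive.

Section Defs.
Variable Sigma : finType.

Record IArray : Type := {
  ia_Q : finType;
  ia_sharp : ia_Q;                              (* border state #   *)
  ia_lam : ia_Q;                                (* quiescent state  *)
  ia_acc : pred ia_Q;
  ia_delta : ia_Q -> ia_Q -> ia_Q -> ia_Q;      (* delta(<c-1>,<c>,<c+1>) *)
  ia_input : Sigma -> ia_Q -> ia_Q -> ia_Q -> ia_Q (* delta_input(w_t,<0>,<1>,<2>) *)
}.

(* ia_state A x0 w t c = <c,t>, the state of cell c at time t on input w
   (cells numbered 1..n = size w; x0 is only a default for nth). *)
Fixpoint ia_state (A : IArray) (x0 : Sigma) (w : seq Sigma) (t c : nat)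
  {struct t} : ia_Q A :=
  if (c == 0) || (size w < c) then ia_sharp A
  else if t < c then ia_lam A                          (* not yet reached *)
  else match t with
       | 0 => ia_lam A
       | t'.+1 =>
         if (c == 1) && (t'.+1 <= size w) then
           @ia_input A (nth x0 w t')
             (ia_state A x0 w t' 0) (ia_state A x0 w t' 1) (ia_state A x0 w t' 2)
         else
           @ia_delta A (ia_state A x0 w t' c.-1) (ia_state A x0 w t' c)
             (ia_state A x0 w t' c.+1)
       end.

Definition ia_accepts (A : IArray) (w : seq Sigma) : Prop :=
  match w with
  | [::] => False
  | x0 :: _ => @ia_acc A (ia_state A x0 w (size w) 1)
  end.

Definition RealTime_IA (L : seq Sigma -> Prop) : Prop :=
  exists A : IArray, forall w, L w <-> ia_accepts A w.

Inductive fo_var := VarX | VarY.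
Inductive upred := Pmin | Pmax.

(* hypotheses of a clause, over computation predicates 'I_k *)
Inductive hyp (k : nat) : Type :=
  | HQ of Sigma & nat                     (* Q_s(x-a) /\ x = y *)
  | HU of upred & fo_var & nat & bool     (* U(v-a) if true, ~U(v-a) if false *)
  | HS of 'I_k & nat & nat                (* S(x-a, y-b) *)
  | HSrev of 'I_k & nat & nat.            (* S(y-b, x-a) *)

(* Horn clause  d1 /\ ... /\ dr -> d0 ; d0 = Some R is R(x,y), None is bottom *)
Record clause (k : nat) : Type := Clause {
  cl_hyps : seq (hyp k);
  cl_concl : option 'I_k
}.

(* Phi = exists R_0 .. R_(k-1) (binary), forall x y, conjunction of clauses *)
Record horn_formula : Type := HornFormula {
  hf_k : nat;
  hf_clauses : seq (clause hf_k)
}.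

Definition predp (i : nat) : nat := if 1 < i then i.-1 else i.
Definition minus_k (i a : nat) : nat := iter a predp i.

Definition hyp_sem (k : nat) (w : seq Sigma) (rho : 'I_k -> nat -> nat -> Prop)
    (x y : nat) (h : hyp k) : Prop :=
  match h with
  | HQ s a => nth None (map Some w) (minus_k x a).-1 = Some s /\ x = y
  | HU U v a pos =>
      let p := minus_k (if v is VarX then x else y) a in
      let b := match U with Pmin => p == 1 | Pmax => p == size w end in
      if pos then b = true else b = false
  | HS Sy a b => rho Sy (minus_k x a) (minus_k y b)
  | HSrev Sy a b => rho Sy (minus_k y b) (minus_k x a)
  end.

Definition concl_sem (k : nat) (rho : 'I_k -> nat -> nat -> Prop)
    (x y : nat) (o : option 'I_k) : Prop :=
  match o with Some R => rho R x y | None => False end.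

(* <w> |= Phi ; the relations are given on nat but only ever evaluated on
   the domain [1, size w] *)
Definition models (w : seq Sigma) (Phi : horn_formula) : Prop :=
  exists rho : 'I_(hf_k Phi) -> nat -> nat -> Prop,
    forall x y, 1 <= x <= size w -> 1 <= y <= size w ->
      forall c, List.In c (hf_clauses Phi) ->
        (forall h, List.In h (cl_hyps c) -> hyp_sem w rho x y h) ->
        concl_sem rho x y (cl_concl c).

Definition PredDioESOHorn (L : seq Sigma -> Prop) : Prop :=
  exists Phi : horn_formula, forall w, L w <-> (w <> [::] /\ models w Phi).

End Defs.

(* Main.v *)
(** From arrays to formulas: the state of cell [c] at time [t] is placed at the point [(t, t - c + 1)],
    so that the states it depends on sit at [(x - 1, y)], [(x - 1, y - 1)] and [(x - 1, y - 2)].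

    From formulas to arrays: [w] satisfies a Horn formula iff falsity is not derivable. A fact at
    [(x, y)] is derived from facts at coordinatewise smaller points or their mirror images, and at
    points below [n] it does not depend on where [max] holds. So for [y <= x] it suffices to keep, for
    the points [(x - a, y - b)] with [a, b <= K] and their mirror images, the facts derivable when
    [max] holds nowhere and those derivable when [max] holds at [x]. These finite windows obey a local
    rule: the window at [(x, y)] is a function of those at [(x - 1, y)] and [(x, y - 1)], and of the
    letter [w_x] when [x = y]. Cell [c] at time [t] stores the window at [(t + c - 1, t - c + 1)],
    two grid steps making one step of the array, and cell 1 runs along the diagonal. The local rule is
    obtained from determinism of the windows by choice, not by an explicit fixpoint computation. *)

Require Import Defs.
From Stdlib Require Import ClassicalEpsilon.
From Stdlib Require List.
From mathcomp Require Import all_boot zify.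

Set Implicit Arguments.
Unset Strict Implicit.
Unset Printing Implicit Defensive.

(** * Classical preliminaries, truncated predecessors, list membership *)

Definition holds (P : Prop) : bool :=
  if excluded_middle_informative P then true else false.

Lemma holdsP P : reflect P (holds P).
Proof. by rewrite /holds; case: excluded_middle_informative => H; constructor. Qed.

Lemma holds_eq P Q : (P <-> Q) -> holds P = holds Q.
Proof. by move=> PQ; apply/holdsP/holdsP => /PQ. Qed.

(** This turns determinism into a transition function: [f] picks any preimage under [g] and applies
    [h] to it, and the assumption makes the pick irrelevant. Outside the image of [g] the value is
    the dummy [b0]. *)
Lemma factor_through (I A B : Type) (b0 : B) (g : I -> A) (h : I -> B) :
  (forall i j, g i = g j -> h i = h j) -> exists f : A -> B, forall i, f (g i) = h i.
Proof.
move=> gh; exists (fun a =>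
  match excluded_middle_informative (exists i, g i = a) with
  | left e => h (proj1_sig (constructive_indefinite_description _ e))
  | right _ => b0
  end) => i.
case: excluded_middle_informative => [e|[]]; last by exists i.
by case: (constructive_indefinite_description _ e) => j /= /gh.
Qed.

Lemma minus_kE x a : 0 < x -> minus_k x a = maxn (x - a) 1.
Proof.
move=> x0; elim: a => [|a IHa]; first by rewrite /minus_k /=; lia.
rewrite /minus_k iterS -/(minus_k x a) IHa /predp; case: ifP; lia.
Qed.

Local Arguments minus_k : simpl never.

Lemma minus_k0 x : minus_k x 0 = x.
Proof. by []. Qed.

Lemma minus_k1 x : 1 < x -> minus_k x 1 = x.-1.
Proof. by move=> h; rewrite minus_kE; lia. Qed.

Lemma minus_k2 x : 2 < x -> minus_k x 2 = x.-2.
Proof. by move=> h; rewrite minus_kE; lia. Qed.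

Lemma nth_map_Some (T : Type) (x0 s : T) w i :
  nth None (map Some w) i = Some s -> nth x0 w i = s.
Proof.
case: (ltnP i (size w)) => h; first by rewrite (nth_map x0) // => -[].
by rewrite nth_default // size_map.
Qed.

Lemma if_eqb (b c : bool) : (if b then c = true else c = false) -> c = b.
Proof. by case: b. Qed.

Lemma if_eqb_refl (b : bool) : if b then b = true else b = false.
Proof. by case: b. Qed.

(** On a concrete clause the right-hand side simplifies to a nested conjunction. *)
Lemma In_hyps (T : Type) (P : T -> Prop) s :
  (forall h, List.In h s -> P h) <-> foldr (fun h R => P h /\ R) True s.
Proof.
elim: s => [|h s IH] /=; first by split=> // _ h [].
split=> [H|[Ph /IH H] h' [<-|/H]] //; split; first by apply: H; left.
by apply/IH => h' ?; apply: H; right.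
Qed.

Lemma In_cat T (x : T) s1 s2 : List.In x (s1 ++ s2) <-> List.In x s1 \/ List.In x s2.
Proof. exact: List.in_app_iff. Qed.

Lemma In_map_enum (T : finType) U (f : T -> U) u :
  List.In u (map f (enum T)) <-> exists x, u = f x.
Proof.
have Inm (s : seq T) : List.In u (map f s) <-> exists2 x, x \in s & u = f x.
  elim: s => /= [|y s ->]; first by split=> // -[].
  split=> [[<-|[x xs ->]]|[x]].
  - by exists y; rewrite ?mem_head.
  - by exists x; rewrite // inE xs orbT.
  - by rewrite inE => /orP[/eqP->|xs] ->; [left|right; exists x].
rewrite Inm; split=> [[x _ ->]|[x ->]]; by exists x; rewrite ?mem_enum.
Qed.

(** * Derivability and windows *)

Section LeastModel.

Variables (Sigma : finType) (Phi : horn_formula Sigma).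
Notation k := (hf_k Phi).
Implicit Types (w : nat -> option Sigma) (N x y t : nat).

(* [N] is the position where [max] holds; [N = 0] means that it holds nowhere. *)
Definition hyp_at (w : nat -> option Sigma) (N : nat)
    (rho : 'I_k -> nat -> nat -> Prop) (x y : nat) (h : hyp Sigma k) : Prop :=
  match h with
  | HQ s a => w (minus_k x a) = Some s /\ x = y
  | HU U v a pos =>
      let p := minus_k (if v is VarX then x else y) a in
      (match U with Pmin => p == 1 | Pmax => p == N end) = pos
  | HS T a b => rho T (minus_k x a) (minus_k y b)
  | HSrev T a b => rho T (minus_k y b) (minus_k x a)
  end.

(* [None] stands for falsity, which is propagated to all larger points. *)
Definition closed w N (rho : option 'I_k -> nat -> nat -> Prop) : Prop :=
  forall x y, 0 < x -> 0 < y ->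
  (forall c, List.In c (hf_clauses Phi) ->
     (forall h, List.In h (cl_hyps c) -> hyp_at w N (fun R => rho (Some R)) x y h) ->
     rho (cl_concl c) x y) /\
  (forall a b, a <= 1 -> b <= 1 -> rho None (minus_k x a) (minus_k y b) -> rho None x y).

(** Impredicative form of the least model, with falsity treated as one more predicate. *)
Definition derivable w N o x y : Prop := forall rho, closed w N rho -> rho o x y.

Lemma hyp_at_mono w N (rho rho' : 'I_k -> nat -> nat -> Prop) x y h :
    (forall R x' y', rho R x' y' -> rho' R x' y') ->
  hyp_at w N rho x y h -> hyp_at w N rho' x y h.
Proof. by move=> le; case: h => //= *; apply: le. Qed.

Lemma derivable_closed w N : closed w N (derivable w N).
Proof.
move=> x y x0 y0; split=> [c cin hyps rho cl|a b a1 b1 d rho cl].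
  apply: ((cl x y x0 y0).1 _ cin) => h hin.
  by apply: hyp_at_mono (hyps h hin) => R x' y' /(_ rho cl).
exact: ((cl x y x0 y0).2 _ _ a1 b1 (d rho cl)).
Qed.

Lemma derivable_ind w N (P : option 'I_k -> nat -> nat -> Prop) :
  closed w N (fun o x y => derivable w N o x y /\ P o x y) ->
  forall o x y, derivable w N o x y -> P o x y.
Proof. by move=> cl o x y /(_ _ cl) []. Qed.

Variable K : nat.
(** Falsity propagates by steps of length at most 1, which must stay within the radius [K]. *)
Hypothesis K_gt0 : 0 < K.

Definition hyp_radius (h : hyp Sigma k) : nat :=
  match h with
  | HQ _ a => a | HU _ _ a _ => a | HS _ a b => maxn a b | HSrev _ a b => maxn a b
  end.

Hypothesis K_bound : forall c h,
  List.In c (hf_clauses Phi) -> List.In h (cl_hyps c) -> hyp_radius h <= K.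

(* [H] need only be a simulation up to facts that are already known to transfer. *)
Lemma derivable_sim w N w' N' (H : nat -> nat -> nat -> nat -> Prop) :
    (forall x y x' y', H x y x' y' -> H y x y' x') ->
    (forall x y x' y', H x y x' y' ->
       [/\ 0 < x', x = y -> x' = y' & forall a, a <= K ->
        [/\ (minus_k x a == 1) = (minus_k x' a == 1),
            (minus_k x a == N) = (minus_k x' a == N')
          & x = y -> w (minus_k x a) = w' (minus_k x' a)]]) ->
    (forall x y x' y' a b, H x y x' y' -> a <= K -> b <= K ->
       let (u, v) := (minus_k x a, minus_k y b) in
       let (u', v') := (minus_k x' a, minus_k y' b) in
       H u v u' v' \/ forall o, (derivable w N o u v -> derivable w' N' o u' v') /\
                                (derivable w N o v u -> derivable w' N' o v' u')) ->
  forall o x y x' y', H x y x' y' -> derivable w N o x y -> derivable w' N' o x' y'.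
Proof.
move=> Hsym Hloc Hstep o x y x' y' Hxy d; move: o x y d x' y' Hxy.
apply: derivable_ind => x y x0 y0.
have hS o a b x' y' : H x y x' y' -> a <= K -> b <= K ->
    derivable w N o (minus_k x a) (minus_k y b) /\
      (forall x' y', H (minus_k x a) (minus_k y b) x' y' -> derivable w' N' o x' y') ->
    derivable w' N' o (minus_k x' a) (minus_k y' b).
  move=> Hxy aK bK [d IH].
  by case: (Hstep _ _ _ _ _ _ Hxy aK bK) => [/IH //|/(_ o) [/(_ d)]].
split=> [c cin hyps|a b a1 b1 dIH].
  split=> [|x' y' Hxy].
    apply: ((derivable_closed _ _ x0 y0).1 _ cin) => h hin.
    by apply: hyp_at_mono (hyps h hin) => R x' y' [].
  have [x'0 eqxy flx] := Hloc _ _ _ _ Hxy.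
  have [y'0 _ fly] := Hloc _ _ _ _ (Hsym _ _ _ _ Hxy).
  apply: ((derivable_closed _ _ x'0 y'0).1 _ cin) => h hin.
  have := K_bound cin hin; have := hyps h hin; case: h {hin} => /=.
  - move=> s a [ws xy] aK; split; last exact: eqxy.
    by have [_ _ <-] := flx a aK.
  - move=> U v a pos + aK; have [ex1 exN _] := flx a aK; have [ey1 eyN _] := fly a aK.
    by case: U; case: v; rewrite ?ex1 ?exN ?ey1 ?eyN.
  - by move=> T a b dIH abK; apply: hS dIH; rewrite ?Hxy //; lia.
  (* A reversed hypothesis reads the mirror point: either the symmetry of [H] leads back to the
     induction hypothesis, or the second implication of the step assumption applies. *)
  - move=> T a b [d IH] abK.
    have [] := Hstep _ _ _ _ a b Hxy; [lia|lia|by move=> /Hsym /IH|].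
    by case/(_ (Some T)) => _ /(_ d).
split=> [|x' y' Hxy].
  exact: (derivable_closed _ _ x0 y0).2 _ _ a1 b1 dIH.1.
have [x'0 _ _] := Hloc _ _ _ _ Hxy.
have [y'0 _ _] := Hloc _ _ _ _ (Hsym _ _ _ _ Hxy).
apply: ((derivable_closed _ _ x'0 y'0).2 _ _ a1 b1).
by apply: hS dIH => //; lia.
Qed.

(** Reading backwards from a point below [N] stays within [[1, N - 1]], where the tests against [N]
    and against 0 both fail. So the identity on these points is a simulation in both directions. *)
Lemma derivable_below_max w N o x y :
  0 < x < N -> 0 < y < N -> derivable w N o x y <-> derivable w 0 o x y.
Proof.
move=> xN yN.
pose H x y x' y' := [/\ 0 < x < N, 0 < y < N, x' = x & y' = y].
have Hsym u v u' v' : H u v u' v' -> H v u v' u' by case=> *; split.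
have Hstep u v u' v' a b : H u v u' v' ->
    H (minus_k u a) (minus_k v b) (minus_k u' a) (minus_k v' b).
  move=> [hu hv -> ->]; rewrite /H !minus_kE; [|lia|lia].
  by split=> //; lia.
have Hxy : H x y x y by [].
split; apply: (derivable_sim (H := H)) Hxy => //.
- move=> u v _ _ [hu hv -> ->]; split=> //; first lia.
  move=> a aK; split=> //; rewrite minus_kE; lia.
- by move=> u v u' v' a b hH _ _; left; apply: Hstep.
- move=> u v _ _ [hu hv -> ->]; split=> //; first lia.
  move=> a aK; split=> //; rewrite minus_kE; lia.
- by move=> u v u' v' a b hH _ _; left; apply: Hstep.
Qed.

(** * Finite observations at a point *)

Definition obs_type : finType :=
  (option Sigma * (bool * bool * bool * bool)
    * {ffun option 'I_k -> bool} * {ffun option 'I_k -> bool})%type.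

(** Letters are recorded on the diagonal only, since clauses read them only where [x = y]. The last
    two components cover the point and its mirror image. *)
Definition obs w N u v : obs_type :=
  (if u == v then w u else None, (u == 1, v == 1, u == N, v == N),
   [ffun o => holds (derivable w N o u v)], [ffun o => holds (derivable w N o v u)]).

Lemma obs_swap w N w' N' u v u' v' :
  obs w N u v = obs w' N' u' v' -> obs w N v u = obs w' N' v' u'.
Proof.
rewrite /obs [v == u]eq_sym [v' == u']eq_sym => -[hw -> -> -> -> -> ->].
congr (_, _, _, _); move: hw.
by do 2![case: eqP => [->|_]].
Qed.

Lemma obs_derivable w N w' N' u v u' v' :
  obs w N u v = obs w' N' u' v' ->
  forall o, (derivable w N o u v <-> derivable w' N' o u' v') /\
            (derivable w N o v u <-> derivable w' N' o v' u').
Proof.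
move=> [_ _ _ _ _ /ffunP e1 /ffunP e2] o.
have := e1 o; have := e2 o; rewrite !ffunE => h2 h1.
by split; split=> /holdsP h; apply/holdsP; [rewrite -h1|rewrite h1|rewrite -h2|rewrite h2].
Qed.

Lemma obs_below_max w N u v :
  0 < u < N -> 0 < v < N -> obs w N u v = obs w 0 u v.
Proof.
move=> hu hv; rewrite /obs.
have -> : (u == N) = (u == 0) by lia.
have -> : (v == N) = (v == 0) by lia.
congr (_, _, _, _); apply/ffunP => o; rewrite !ffunE; apply: holds_eq;
  exact: derivable_below_max.
Qed.

(** The simulation relates only the two centres and their mirror images. A backward step that stays
    at the centre remains in the relation; any other step reaches a point whose facts transfer
    because its observations agree. *)
Lemma obs_local_sub w N w' N' x y x' y' :
    0 < x -> 0 < y -> 0 < x' -> 0 < y' ->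
    (x == y) = (x' == y') -> (x = y -> w x = w' x') ->
    (x == 1) = (x' == 1) -> (y == 1) = (y' == 1) ->
    (x == N) = (x' == N') -> (y == N) = (y' == N') ->
    (forall a b, a <= K -> b <= K ->
      [/\ minus_k x a = x, minus_k y b = y, minus_k x' a = x' & minus_k y' b = y'] \/
      obs w N (minus_k x a) (minus_k y b) = obs w' N' (minus_k x' a) (minus_k y' b)) ->
  forall o, (derivable w N o x y -> derivable w' N' o x' y') /\
            (derivable w N o y x -> derivable w' N' o y' x').
Proof.
move=> x0 y0 x'0 y'0 exy ew ex ey exN eyN near o.
pose H u v u' v' := [/\ u = x, v = y, u' = x' & v' = y']
                 \/ [/\ u = y, v = x, u' = y' & v' = x'].
have sim := @derivable_sim w N w' N' H.
suff Hgen o' u v u' v' : H u v u' v' -> derivable w N o' u v -> derivable w' N' o' u' v'.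
  by split; apply: Hgen; [left|right].
apply: sim => {o o' u v u' v'} [u v u' v'|u v u' v'|u v u' v' a b].
- by case=> -[-> -> -> ->]; [right|left].
- case=> -[-> -> -> ->]; split=> //; try (move=> e; lia).
  + move=> a aK; split.
    * by case: (near a 0 aK (leq0n K)) => [[-> _ -> _]|[]].
    * by case: (near a 0 aK (leq0n K)) => [[-> _ -> _]|[]].
    (* For [x = y] the point [(x - a, x - a)] is on the diagonal, so its observation contains the
       letter. *)
    * move=> e; have e' : x' = y' by lia.
      by subst y y'; case: (near a a aK aK) => [[-> _ -> _]|[]]; rewrite ?eqxx; auto.
  + move=> a aK; split.
    * by case: (near 0 a (leq0n K) aK) => [[_ -> _ ->]|[]].
    * by case: (near 0 a (leq0n K) aK) => [[_ -> _ ->]|[]].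
    * move=> e; have e' : x' = y' by lia.
      by subst y y'; case: (near a a aK aK) => [[-> _ -> _]|[]]; rewrite ?eqxx; auto.
- case=> -[-> -> -> ->] aK bK.
  + case: (near a b aK bK) => [[-> -> -> ->]|/obs_derivable e]; first by left; left.
    by right=> o; have [[? _] [? _]] := e o.
  + case: (near b a bK aK) => [[-> -> -> ->]|/obs_derivable e]; first by left; right.
    by right=> o; have [[? _] [? _]] := e o.
Qed.

Lemma obs_local w N w' N' x y x' y' :
    0 < x -> 0 < y -> 0 < x' -> 0 < y' ->
    (x == y) = (x' == y') -> (x = y -> w x = w' x') ->
    (x == 1) = (x' == 1) -> (y == 1) = (y' == 1) ->
    (x == N) = (x' == N') -> (y == N) = (y' == N') ->
    (forall a b, a <= K -> b <= K ->
      [/\ minus_k x a = x, minus_k y b = y, minus_k x' a = x' & minus_k y' b = y'] \/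
      obs w N (minus_k x a) (minus_k y b) = obs w' N' (minus_k x' a) (minus_k y' b)) ->
  obs w N x y = obs w' N' x' y'.
Proof.
move=> x0 y0 x'0 y'0 exy ew ex ey exN eyN near.
have sub := obs_local_sub x0 y0 x'0 y'0 exy ew ex ey exN eyN near.
have sub' : forall o, (derivable w' N' o x' y' -> derivable w N o x y) /\
                      (derivable w' N' o y' x' -> derivable w N o y x).
  apply: obs_local_sub => // [e|a b aK bK]; first by rewrite ew //; lia.
  by case: (near a b aK bK) => [[-> -> -> ->]|->]; [left|right].
rewrite /obs ex ey exN eyN -exy; congr (_, _, _, _).
- by case: eqP => // /ew.
- by apply/ffunP => o; rewrite !ffunE; apply: holds_eq; split; case: (sub o) (sub' o) => ? ? [].
- by apply/ffunP => o; rewrite !ffunE; apply: holds_eq; split; case: (sub o) (sub' o) => ? ? [].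
Qed.

(** * Windows and their local rule *)

Definition window_type : finType := {ffun 'I_K.+1 * 'I_K.+1 -> obs_type * obs_type}.

Definition window w x y : window_type :=
  [ffun p : 'I_K.+1 * 'I_K.+1 =>
     (obs w 0 (minus_k x p.1) (minus_k y p.2), obs w x (minus_k x p.1) (minus_k y p.2))].

Lemma windowP w x y w' x' y' :
  window w x y = window w' x' y' <->
  forall a b, a <= K -> b <= K ->
    obs w 0 (minus_k x a) (minus_k y b) = obs w' 0 (minus_k x' a) (minus_k y' b) /\
    obs w x (minus_k x a) (minus_k y b) = obs w' x' (minus_k x' a) (minus_k y' b).
Proof.
split=> [/ffunP e a b aK bK|e].
  have := e (Ordinal (aK : a < K.+1), Ordinal (bK : b < K.+1)).
  by rewrite !ffunE => e'; split; [exact: (congr1 fst e')|exact: (congr1 snd e')].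
apply/ffunP => -[a b]; rewrite !ffunE /=.
by have [-> ->] := e a b (ltn_ord a) (ltn_ord b).
Qed.

(** Outside the triangle the value [None] will serve both as border state and as quiescent state. *)
Definition opt_window w x y : option window_type :=
  if 0 < y <= x then Some (window w x y) else None.

(** Except for the centre, every point of the window lies in the window below ([b > 0]) or in the
    one to the left ([a > 0], [b = 0]); if [y = 1], all [b] give the same point. The centre then
    follows by [obs_local]. *)
Lemma opt_window_off_diag w x y w' x' y' :
  y < x -> y' < x' ->
  opt_window w x.-1 y = opt_window w' x'.-1 y' -> opt_window w x y.-1 = opt_window w' x' y'.-1 ->
  opt_window w x y = opt_window w' x' y'.
Proof.
move=> yx yx'; rewrite /opt_window.
case: (posnP y) => [->|y0]; case: (posnP y') => [->|y'0]; rewrite ?andbF //=.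
- by rewrite (_ : y' <= x'.-1); [|lia].
- by rewrite (_ : y <= x.-1); [|lia].
have -> : y <= x.-1 by lia. have -> : y' <= x'.-1 by lia.
have -> : y.-1 <= x by lia. have -> : y'.-1 <= x' by lia.
rewrite !andbT (ltnW yx) (ltnW yx') => -[/windowP eL] eD.
(* Here [y = 1] shows as the absence of a window at [y - 1]. *)
have ey : (y == 1) = (y' == 1) by move: eD; do 2![case: ifP => ?] => //; lia.
have eD' : 1 < y -> forall a b, a <= K -> b <= K ->
    obs w 0 (minus_k x a) (minus_k y.-1 b) = obs w' 0 (minus_k x' a) (minus_k y'.-1 b) /\
    obs w x (minus_k x a) (minus_k y.-1 b) = obs w' x' (minus_k x' a) (minus_k y'.-1 b).
  move=> y1; move: eD; have -> : 0 < y.-1 by lia. have -> : 0 < y'.-1 by lia.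
  by case=> /windowP.
have ex : (x == 1) = (x' == 1) by lia.
(* The left window has [max] at [x - 1] instead of [x]. Its entries with [max] nowhere suffice:
   points left of column [x] in this window have both coordinates below [x]. *)
have left0 a : 0 < a -> a <= K ->
    obs w 0 (minus_k x a) y = obs w' 0 (minus_k x' a) y' /\
    obs w x (minus_k x a) y = obs w' x' (minus_k x' a) y'.
  move=> a0 aK; have [] := eL a.-1 0; [lia|lia|].
  have -> : minus_k x.-1 a.-1 = minus_k x a by rewrite !minus_kE; lia.
  have -> : minus_k x'.-1 a.-1 = minus_k x' a by rewrite !minus_kE; lia.
  rewrite /minus_k /= -!/(minus_k _ _) => e _; split=> //.
  have hx : 0 < minus_k x a < x by rewrite minus_kE; lia.
  have hx' : 0 < minus_k x' a < x' by rewrite minus_kE; lia.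
  by rewrite !obs_below_max ?y0 ?y'0.
have near a b : a <= K -> b <= K ->
    [/\ minus_k x a = x, minus_k y b = y, minus_k x' a = x' & minus_k y' b = y'] \/
    (obs w 0 (minus_k x a) (minus_k y b) = obs w' 0 (minus_k x' a) (minus_k y' b) /\
     obs w x (minus_k x a) (minus_k y b) = obs w' x' (minus_k x' a) (minus_k y' b)).
  move=> aK bK.
  case: (posnP b) => [->|b0].
    by case: (posnP a) => [->|a0]; [left|right; exact: left0].
  case: (ltngtP y 1) => [|y1|y1]; first lia.
    right; have [] := eD' y1 a b.-1; [lia|lia|].
    have -> : minus_k y.-1 b.-1 = minus_k y b by rewrite !minus_kE; lia.
    by have -> : minus_k y'.-1 b.-1 = minus_k y' b by rewrite !minus_kE; lia.
  have -> : minus_k y b = y by rewrite minus_kE; lia.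
  have -> : minus_k y' b = y' by rewrite minus_kE; lia.
  by case: (posnP a) => [->|a0]; [left|right; exact: left0].
congr Some; apply/windowP => a b aK bK.
have eloc : obs w 0 x y = obs w' 0 x' y' /\ obs w x x y = obs w' x' x' y'.
  split; apply: obs_local => //; try lia;
  by move=> a' b' aK' bK'; case: (near a' b' aK' bK') => [|[]]; auto.
by case: (near a b aK bK) => // -[-> -> -> ->].
Qed.

(** The left neighbour [(x - 1, x)] is outside the triangle, but [(x - a, x)] is the mirror image of
    [(x, x - a)], which the window at [(x, x - 1)] contains. *)
Lemma opt_window_diag w x w' x' :
  0 < x -> 0 < x' -> w x = w' x' ->
  opt_window w x x.-1 = opt_window w' x' x'.-1 -> opt_window w x x = opt_window w' x' x'.
Proof.
move=> x0 x'0 ew; rewrite /opt_window !leqnn !leq_pred x0 x'0 !andbT /= => eD.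
have ex : (x == 1) = (x' == 1) by move: eD; do 2![case: ifP => ?] => //; lia.
have eD' : 1 < x -> forall a b, a <= K -> b <= K ->
    obs w 0 (minus_k x a) (minus_k x.-1 b) = obs w' 0 (minus_k x' a) (minus_k x'.-1 b) /\
    obs w x (minus_k x a) (minus_k x.-1 b) = obs w' x' (minus_k x' a) (minus_k x'.-1 b).
  move=> y1; move: eD; have -> : 0 < x.-1 by lia. have -> : 0 < x'.-1 by lia.
  by case=> /windowP.
have near a b : a <= K -> b <= K ->
    [/\ minus_k x a = x, minus_k x b = x, minus_k x' a = x' & minus_k x' b = x'] \/
    (obs w 0 (minus_k x a) (minus_k x b) = obs w' 0 (minus_k x' a) (minus_k x' b) /\
     obs w x (minus_k x a) (minus_k x b) = obs w' x' (minus_k x' a) (minus_k x' b)).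
  move=> aK bK; case: (ltngtP x 1) => [|x1|x1]; [lia| |left; split; rewrite minus_kE; lia].
  have down a' b' : a' <= K -> 0 < b' <= K ->
      obs w 0 (minus_k x a') (minus_k x b') = obs w' 0 (minus_k x' a') (minus_k x' b') /\
      obs w x (minus_k x a') (minus_k x b') = obs w' x' (minus_k x' a') (minus_k x' b').
    move=> aK' bK'; have [] := eD' x1 a' b'.-1; [lia|lia|].
    have -> : minus_k x.-1 b'.-1 = minus_k x b' by rewrite !minus_kE; lia.
    by have -> : minus_k x'.-1 b'.-1 = minus_k x' b' by rewrite !minus_kE; lia.
  case: (posnP b) => [->|b0]; last by right; apply: down; rewrite ?b0.
  case: (posnP a) => [->|a0]; first by left.
  by right; have [||] := down 0 a; rewrite ?a0 // => /obs_swap ? /obs_swap.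
congr Some; apply/windowP => a b aK bK.
have eloc : obs w 0 x x = obs w' 0 x' x' /\ obs w x x x = obs w' x' x' x'.
  split; apply: obs_local => //; try lia;
  by move=> a' b' aK' bK'; case: (near a' b' aK' bK') => [|[]]; auto.
by case: (near a b aK bK) => // -[-> -> -> ->].
Qed.

(** * The cells of the array *)

Definition cell w t c : option window_type := opt_window w (t + c - 1) (t + 1 - c).

(** The two intermediate points are [(t + c - 1, t + 2 - c)], fed by cells [c - 1] and [c], and
    [(t + c, t + 1 - c)], fed by cells [c] and [c + 1]. As [c > 1], all points computed are off the
    diagonal. *)
Lemma cell_step w t c w' t' c' :
  1 < c -> 1 < c' ->
  cell w t c.-1 = cell w' t' c'.-1 -> cell w t c = cell w' t' c' ->
  cell w t c.+1 = cell w' t' c'.+1 -> cell w t.+1 c = cell w' t'.+1 c'.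
Proof.
rewrite /cell => c1 c'1 eL eM eR.
have eLM : opt_window w (t + c - 1) (t + 2 - c) = opt_window w' (t' + c' - 1) (t' + 2 - c').
  apply: opt_window_off_diag; [lia|lia| |].
    by congr (_ = _): eL; congr opt_window; lia.
  by congr (_ = _): eM; congr opt_window; lia.
have eMR : opt_window w (t + c) (t + 1 - c) = opt_window w' (t' + c') (t' + 1 - c').
  apply: opt_window_off_diag; [lia|lia| |].
    by congr (_ = _): eM; congr opt_window; lia.
  by congr (_ = _): eR; congr opt_window; lia.
apply: opt_window_off_diag; [lia|lia| |].
  by congr (_ = _): eLM; congr opt_window; lia.
by congr (_ = _): eMR; congr opt_window; lia.
Qed.

(** From [(t, t)] the path to [(t + 1, t + 1)] passes through [(t + 1, t)], whose lower neighbour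
    belongs to cell 2. The letter enters in the last step. *)
Lemma cell_step1 w t w' t' :
  w t.+1 = w' t'.+1 -> cell w t 1 = cell w' t' 1 -> cell w t 2 = cell w' t' 2 ->
  cell w t.+1 1 = cell w' t'.+1 1.
Proof.
rewrite /cell => ew eM eR.
have eMR : opt_window w t.+1 t = opt_window w' t'.+1 t'.
  apply: opt_window_off_diag => //.
    by congr (_ = _): eM; congr opt_window; lia.
  by congr (_ = _): eR; congr opt_window; lia.
have -> : t.+1 + 1 - 1 = t.+1 by lia. have -> : t'.+1 + 1 - 1 = t'.+1 by lia.
exact: opt_window_diag.
Qed.

Lemma cell_array : exists A : IArray Sigma, forall (x0 : Sigma) v,
  ia_accepts A (x0 :: v) <->
  ~ derivable (fun i => nth None (map Some (x0 :: v)) i.-1) (size v).+1 None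
      (size v).+1 (size v).+1.
Proof.
have [f fE] : exists f : option window_type * option window_type * option window_type ->
      option window_type, forall i : (nat -> option Sigma) * nat * nat,
    f (cell i.1.1 i.1.2 i.2.+1, cell i.1.1 i.1.2 i.2.+2, cell i.1.1 i.1.2 i.2.+3) =
    cell i.1.1 i.1.2.+1 i.2.+2.
  apply: (factor_through None (g := fun i : (nat -> option Sigma) * nat * nat =>
    (cell i.1.1 i.1.2 i.2.+1, cell i.1.1 i.1.2 i.2.+2, cell i.1.1 i.1.2 i.2.+3))).
  by move=> [[w t] c] [[w' t'] c'] /= => e; apply: cell_step => //;
    [exact: (congr1 (fun p => p.1.1) e)|exact: (congr1 (fun p => p.1.2) e)|exact: (congr1 snd e)].
have [g gE] : exists g : option Sigma * option window_type * option window_type ->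
      option window_type, forall i : (nat -> option Sigma) * nat,
    g (i.1 i.2.+1, cell i.1 i.2 1, cell i.1 i.2 2) = cell i.1 i.2.+1 1.
  apply: (factor_through None (g := fun i : (nat -> option Sigma) * nat =>
    (i.1 i.2.+1, cell i.1 i.2 1, cell i.1 i.2 2))).
  by move=> [w t] [w' t'] /= => e; apply: cell_step1 => //;
    [exact: (congr1 (fun p => p.1.1) e)|exact: (congr1 (fun p => p.1.2) e)|exact: (congr1 snd e)].
pose A := {|
  ia_Q := option window_type; ia_sharp := None; ia_lam := None;
  (* The window at [(n, n)] is read at its centre, in the entry with [max] at [n], for the
     derivability of falsity. *)
  ia_acc := fun q => if q is Some W then ~~ (W (ord0, ord0)).2.1.2 None else false;
  ia_delta := fun p q r => f (p, q, r);
  ia_input := fun s _ q r => g (Some s, q, r) |}.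
exists A => x0 v; set w := fun i => _; set n := (size v).+1.
(* For [t < c] truncated subtraction gives [y = 0]; for [c = 0] the point has [y > x]. *)
have cell_out t c : (c == 0) || (t < c) -> cell w t c = None.
  by move=> h; rewrite /cell /opt_window; case: ifP => //; lia.
(* Up to time [n] cell 1 receives a letter at each step, and a cell beyond [n] satisfies [t < c], so
   its border state agrees with [cell]. *)
have stE t c : t <= n -> ia_state A x0 (x0 :: v) t c = cell w t c.
  elim: t c => [|t IH] c tn.
    rewrite cell_out; last lia.
    by rewrite /=; do !case: ifP.
  have {}IH c' := IH c' (ltnW tn).
  rewrite [LHS]/=; case: ifP => [h|h1]; first by rewrite cell_out //=; lia.
  case: ifP => [h|h2]; first by rewrite cell_out //= h orbT.
  case: ifP => h3.
    have {h1 h2 h3}-> : c = 1 by lia.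
    rewrite !IH.
    rewrite -(gE (w, t)) /=; congr (g (_, _, _)).
    by rewrite /w (nth_map x0) //=.
  have c1 : 1 < c by lia.
  case: c c1 {h1 h2 h3} => [|[|c]] // _.
  by rewrite !IH -(fE (w, t, c)).
rewrite /ia_accepts stE // /cell /opt_window.
have -> : n + 1 - 1 = n by lia.
rewrite /n !leqnn /= ffunE /= ffunE.
by split=> [/negP h /holdsP //|h]; apply/negP => /holdsP.
Qed.

End LeastModel.

(** * Satisfaction as underivability of falsity *)

Arguments derivable {Sigma} Phi w N o x y.

Lemma models_derivable (Sigma : finType) (Phi : horn_formula Sigma) (w : seq Sigma) :
  w <> [::] ->
  models w Phi <->
  ~ derivable Phi (fun i => nth None (map Some w) i.-1) (size w) None (size w) (size w).
Proof.
set lt := fun i => _; set n := size w => wn.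
have n0 : 0 < n by rewrite lt0n size_eq0; apply/eqP.
(* A model, restricted to the domain and with falsity read as [False], is closed. *)
split=> [[rho mod] /(_ (fun o x y => 0 < x <= n -> 0 < y <= n -> concl_sem rho x y o)) d|nd].
  apply: d; rewrite ?n0 ?leqnn // => x y x0 y0; split=> [c cin hyps xn yn|a b _ _ h xn yn].
    apply: mod cin _ => // h hin; have := hyps h hin.
    case: h {hin} => [s a|U v a []|T a b|T a b] //=; apply; rewrite minus_kE; lia.
  by apply: h; rewrite minus_kE //; lia.
(* Falsity anywhere in the domain would propagate to the corner [(n, n)]. Hence the derivable facts
   form a model. *)
have up x y : 0 < x <= n -> 0 < y <= n -> ~ derivable Phi lt n None x y.
  move=> + + d.
  have cl := @derivable_closed _ Phi lt n.
  have [i] := ubnP (n - x + (n - y)); elim: i x y d => // i IH x y d lei xn yn.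
  have [|xlt|xe] := ltngtP x n; [move=> xlt|lia|].
    apply: (IH x.+1 y); try lia.
    apply: ((cl x.+1 y _ _).2 1 0) => //; first lia.
    by have -> : minus_k x.+1 1 = x by rewrite minus_kE; lia.
  have [|ylt|ye] := ltngtP y n; [move=> ylt|lia|].
    apply: (IH x y.+1); try lia.
    apply: ((cl x y.+1 _ _).2 0 1) => //; first lia.
    by have -> : minus_k y.+1 1 = y by rewrite minus_kE; lia.
  by apply: nd; move: d; rewrite xe ye.
exists (fun R => derivable Phi lt n (Some R)) => x y xn yn c cin hyps.
have : derivable Phi lt n (cl_concl c) x y.
  apply: ((@derivable_closed _ Phi lt n x y _ _).1 c cin) => [||h hin]; [lia|lia|].
  by have := hyps h hin; case: h {hin} => [s a|U v a []|T a b|T a b].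
by case: (cl_concl c) => //= /up; apply.
Qed.

Lemma hyp_radius_bounded (Sigma : finType) (Phi : horn_formula Sigma) :
  exists2 K, 0 < K & forall c h,
    List.In c (hf_clauses Phi) -> List.In h (cl_hyps c) -> hyp_radius h <= K.
Proof.
exists (\max_(c <- hf_clauses Phi) \max_(h <- cl_hyps c) hyp_radius h).+1 => // c h.
have le_max T (F : T -> nat) s x : List.In x s -> F x <= \max_(y <- s) F y.
  elim: s => //= y s IH; rewrite big_cons => -[->|/IH]; first exact: leq_maxl.
  by move/leq_trans; apply; exact: leq_maxr.
move=> /(le_max _ (fun c => \max_(h <- cl_hyps c) hyp_radius h)) cle.
move=> /(le_max _ (@hyp_radius _ Phi)) hle.
exact: leq_trans hle (leq_trans cle (leqnSn _)).
Qed.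

Lemma horn_to_array (Sigma : finType) (L : seq Sigma -> Prop) :
  PredDioESOHorn L -> RealTime_IA L.
Proof.
move=> [Phi LPhi]; have [K K0 KP] := hyp_radius_bounded Phi.
have [A AP] := cell_array K0 KP.
exists A => w; rewrite LPhi; case: w => [|x0 v]; first by split=> [[]|].
rewrite AP; split=> [[wn]|h]; first by move/(models_derivable _ wn).
by split=> //; apply/models_derivable.
Qed.

(** * The formula of an array *)

Section ArrayToHorn.

Variables (Sigma : finType) (A : IArray Sigma).
Notation Q := (ia_Q A).

Definition edge (b : bool) : Q := if b then ia_sharp A else ia_lam A.

Section Grid.

Variables (x0 : Sigma) (w : seq Sigma).
Notation n := (size w).

Definition grid_state x y : Q := ia_state A x0 w x (x.+1 - y).

(** For [y = 1] the cell is number [x], not yet reached at time [x - 1]. *)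
Definition mid_state x y : Q :=
  if y == 1 then ia_lam A else grid_state x.-1 y.-1.

(* At time [x] cell [x + 1] is either not yet reached or, when [x = n], a border cell. *)
Definition right_state x y : Q :=
  if y == 1 then edge (x == n)
  else if y == 2 then ia_lam A else grid_state x.-1 y.-2.

Lemma ia_state_sharp t c : (c == 0) || (n < c) -> ia_state A x0 w t c = ia_sharp A.
Proof. by case: t => [|t] /= ->. Qed.

Lemma ia_state_lam t c : 0 < c <= n -> t < c -> ia_state A x0 w t c = ia_lam A.
Proof.
by move=> h lt; case: t lt => [|t] /= lt; rewrite lt ifF //; lia.
Qed.

(** The diagonal carries cell 1, which reads the input and has the border on its left. *)
Lemma grid_state_step x y : 0 < y <= x -> x <= n ->
  grid_state x y =
  if x == y then ia_input (nth x0 w x.-1) (ia_sharp A) (mid_state x y) (right_state x y)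
  else ia_delta (grid_state x.-1 y) (mid_state x y) (right_state x y).
Proof.
case: x => [|x] hy xn; first lia.
have hM : ia_state A x0 w x (x.+2 - y) = mid_state x.+1 y.
  rewrite /mid_state; case: eqP => [->|y1]; first by apply: ia_state_lam; lia.
  by rewrite /grid_state /=; congr ia_state; lia.
have hR : ia_state A x0 w x (x.+2 - y).+1 = right_state x.+1 y.
  rewrite /right_state /edge; case: eqP => [->|y1].
    case: eqP => xe; first by apply: ia_state_sharp; lia.
    by apply: ia_state_lam; lia.
  case: eqP => [->|y2]; first by apply: ia_state_lam; lia.
  by rewrite /grid_state /=; congr ia_state; lia.
rewrite {1}/grid_state /= ifF; last lia.
rewrite ifF; last lia.
rewrite hM; case: (x.+1 =P y) => xy.
  rewrite ifT; last lia.
  rewrite ia_state_sharp // -hR -hM.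
  by congr ia_input; congr ia_state; lia.
rewrite ifF ?hR; last lia.
by congr ia_delta; rewrite /grid_state; congr ia_state; lia.
Qed.

End Grid.

Arguments grid_state : simpl never.

(** * The clauses and their correctness *)

Notation rk := (@enum_rank Q).
Notation hypA := (hyp Sigma #|Q|).
Notation clauseA := (clause Sigma #|Q|).

Definition hmin v a b : hypA := HU _ _ Pmin v a b.
Definition hmax v b : hypA := HU _ _ Pmax v 0 b.
Definition hQ s : hypA := HQ _ s 0.
Definition hst q a b : hypA := HS _ (rk q) a b.

(** In both families the three clauses treat [y = 1], [y = 2] and [y > 2], the cases of [mid_state]
    and [right_state], told apart by [min] at [y] and [y - 1]; on the diagonal [x] stands for
    [y]. *)
Definition diag_clause1 (p : Sigma * bool) : clauseA :=
  Clause [:: hQ p.1; hmin VarX 0 true; hmax VarX p.2]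
    (Some (rk (ia_input p.1 (ia_sharp A) (ia_lam A) (edge p.2)))).

Definition diag_clause2 (p : Sigma * Q) : clauseA :=
  Clause [:: hQ p.1; hmin VarX 0 false; hmin VarX 1 true; hst p.2 1 1]
    (Some (rk (ia_input p.1 (ia_sharp A) p.2 (ia_lam A)))).

Definition diag_clause3 (p : Sigma * Q * Q) : clauseA :=
  Clause [:: hQ p.1.1; hmin VarX 1 false; hst p.1.2 1 1; hst p.2 1 2]
    (Some (rk (ia_input p.1.1 (ia_sharp A) p.1.2 p.2))).

(** The guard that [x] is not minimal makes [x - 1] a true predecessor. That [y < x] is not stated:
    it follows from the state fact at [(x - 1, y)] when states occur only in the triangle. *)
Definition off_clause1 (p : Q * bool) : clauseA :=
  Clause [:: hmin VarX 0 false; hmin VarY 0 true; hmax VarX p.2; hst p.1 1 0]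
    (Some (rk (ia_delta p.1 (ia_lam A) (edge p.2)))).

Definition off_clause2 (p : Q * Q) : clauseA :=
  Clause [:: hmin VarX 0 false; hmin VarY 0 false; hmin VarY 1 true; hst p.1 1 0; hst p.2 1 1]
    (Some (rk (ia_delta p.1 p.2 (ia_lam A)))).

Definition off_clause3 (p : Q * Q * Q) : clauseA :=
  Clause [:: hmin VarX 0 false; hmin VarY 1 false; hst p.1.1 1 0; hst p.1.2 1 1; hst p.2 1 2]
    (Some (rk (ia_delta p.1.1 p.1.2 p.2))).

(* For accepting [q] this is a tautology. *)
Definition reject_clause (q : Q) : clauseA :=
  Clause [:: hmax VarX true; hmax VarY true; hst q 0 0]
    (if ia_acc q then Some (rk q) else None).

Definition array_formula : horn_formula Sigma :=
  HornFormula (flatten [::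
    map diag_clause1 (enum {: Sigma * bool}); map diag_clause2 (enum {: Sigma * Q});
    map diag_clause3 (enum {: Sigma * Q * Q}); map off_clause1 (enum {: Q * bool});
    map off_clause2 (enum {: Q * Q}); map off_clause3 (enum {: Q * Q * Q});
    map reject_clause (enum Q)]).

Lemma In_array_formula c :
  List.In c (hf_clauses array_formula) <->
  (exists p, c = diag_clause1 p) \/ (exists p, c = diag_clause2 p) \/
  (exists p, c = diag_clause3 p) \/ (exists p, c = off_clause1 p) \/
  (exists p, c = off_clause2 p) \/ (exists p, c = off_clause3 p) \/
  (exists q, c = reject_clause q).
Proof. by rewrite /= cats0 !In_cat !In_map_enum. Qed.

Lemma accepts_models x0 w :
  ia_acc (ia_state A x0 w (size w) 1) -> models w array_formula.
Proof.
(* The run itself is the model; the conjunct [y <= x] keeps the off-diagonal clauses from firing on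
   the diagonal. *)
move=> acc; pose rho (R : 'I_#|Q|) x y := y <= x /\ grid_state x0 w x y = enum_val R.
exists rho => x y hx hy c /In_array_formula cin /In_hyps hyps.
have yx_pos : y <= x -> 0 < y <= x by lia.
have xn : x <= size w by lia.
have step yx := grid_state_step x0 (yx_pos yx) xn.
rewrite /mid_state /right_state /edge in step.
case: cin hyps => [[[s b] ->]|[[[s q] ->]|[[[[s q1] q2] ->]|[[[q b] ->]|
  [[[q0 q1] ->]|[[[[q0 q1] q2] ->]|[q ->]]]]]]] /=;
  rewrite /rho ?enum_rankK ?minus_k0.
- move=> [[hs xy] [x1 [/if_eqb exn _]]]; subst y; split=> //.
  by rewrite step // eqxx x1 exn (nth_map_Some x0 hs).
- move=> [[hs xy] [x1 [x2 [[_ st] _]]]]; subst y; split=> //.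
  have ex : x = 2 by move: x2; rewrite minus_kE; lia.
  by subst x; rewrite step //= (nth_map_Some x0 hs) -st.
- move=> [[hs xy] [x2 [[_ st1] [[_ st2] _]]]]; subst y; split=> //.
  have ex : 2 < x by move: x2; rewrite minus_kE; lia.
  rewrite step // eqxx (nth_map_Some x0 hs) !ifF; [|lia..].
  by rewrite -st1 -st2 !minus_k1 ?minus_k2 //; lia.
- move=> [x1 [y1 [/if_eqb exn [[yx st] _]]]].
  have ex : 1 < x by lia.
  move: yx st; rewrite minus_k1 // => yx st; split; first lia.
  by rewrite step; [rewrite y1 exn ifF ?st //; lia|lia].
- move=> [x1 [y1 [y2 [[yx st0] [[_ st1] _]]]]].
  have ex : 1 < x by lia.
  have ey : y = 2 by move: y2; rewrite minus_kE; lia.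
  subst y; move: yx st0 st1; rewrite !minus_k1 // => yx st0 st1; split; first lia.
  by rewrite step; [rewrite ifF ?st0 ?st1 //=; lia|lia].
- move=> [x1 [y2 [[yx st0] [[_ st1] [[_ st2] _]]]]].
  have ex : 1 < x by lia.
  have ey : 2 < y by move: y2; rewrite minus_kE; lia.
  move: yx st0 st1 st2; rewrite !minus_k1 ?minus_k2 //; last lia.
  move=> yx st0 st1 st2; split; first lia.
  rewrite step; last lia.
  by rewrite !ifF ?st0 ?st1 ?st2 //; lia.
- move=> [/eqP ex [/eqP ey [[yx st] _]]]; subst x y; case: ifP => accq /=.
    by rewrite enum_rankK.
  by move: accq; rewrite -st /grid_state subSn // subnn acc.
Qed.

Lemma models_accepts x0 w :
  w <> [::] -> models w array_formula -> ia_acc (ia_state A x0 w (size w) 1).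
Proof.
move=> wn [rho mod]; set n := size w in mod *.
have n0 : 0 < n by rewrite lt0n size_eq0; apply/eqP.
have fire x y c : 0 < x <= n -> 0 < y <= n -> List.In c (hf_clauses array_formula) ->
    foldr (fun h R => hyp_sem w rho x y h /\ R) True (cl_hyps c) ->
    concl_sem rho x y (cl_concl c).
  by move=> hx hy cin /In_hyps; apply: mod.
have letter x : 0 < x <= n -> nth None (map Some w) x.-1 = Some (nth x0 w x.-1).
  by move=> hx; rewrite (nth_map x0) //; rewrite -/n; lia.
(* Every model contains the run. Induction on [x] alone suffices, since the transition clauses read
   states only in column [x - 1]. *)
have st x y : 0 < y <= x -> x <= n -> rho (rk (grid_state x0 w x y)) x y.
  elim/ltn_ind: x y => x IH y hy xn.
  have hx : 0 < x <= n by lia.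
  have hy' : 0 < y <= n by lia.
  rewrite grid_state_step //; case: eqP => [xy|xy].
    subst y; case: (ltngtP x 1) => [|x1|x1]; first lia; last first.
      subst x; rewrite /mid_state /right_state eqxx.
      apply: (fire _ _ (diag_clause1 (_, _))) => //; first by apply/In_array_formula; eauto.
      by rewrite /= !minus_k0 (letter 1) //; do 3!(split=> //); exact: (if_eqb_refl (1 == size w)).
    case: (ltngtP x 2) => [|x2|x2]; first lia; last first.
      subst x; rewrite /mid_state /right_state /=.
      apply: (fire _ _ (diag_clause2 (_, _))) => //; first by apply/In_array_formula; eauto 6.
      by rewrite /= !minus_k0 (letter 2) //; do 4!(split=> //); exact: (IH 1 isT 1).
    rewrite /mid_state /right_state !ifF; [|lia..].
    apply: (fire _ _ (diag_clause3 (_, _, _))) => //; first by apply/In_array_formula; eauto 8.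
    rewrite /= minus_k0 letter // minus_k1 // minus_k2 //; split=> //; split; first lia.
    by split; [apply: IH; lia|split; [apply: IH; lia|]].
  case: (ltngtP y 1) => [|y1|y1]; first lia; last first.
    subst y; rewrite /mid_state /right_state eqxx.
    apply: (fire _ _ (off_clause1 (_, _))) => //; first by apply/In_array_formula; eauto 10.
    rewrite /= !minus_k0 minus_k1; last lia.
    split; first lia; split=> //; split; first exact: (if_eqb_refl (x == size w)).
    by split=> //; apply: IH; lia.
  case: (ltngtP y 2) => [|y2|y2]; first lia; last first.
    subst y; rewrite /mid_state /right_state /=.
    apply: (fire _ _ (off_clause2 (_, _))) => //; first by apply/In_array_formula; eauto 10.
    rewrite /= !minus_k0 !minus_k1; [|lia..].
    split; first lia; split=> //; split=> //.
    by split; [apply: IH; lia|split; [apply: IH; lia|]].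
  rewrite /mid_state /right_state !ifF; [|lia..].
  apply: (fire _ _ (off_clause3 (_, _, _))) => //; first by apply/In_array_formula; eauto 12.
  rewrite /= !minus_k0 !minus_k1 ?minus_k2; [|lia..].
  split; first lia; split; first lia.
  by split; [apply: IH; lia|split; [apply: IH; lia|split; [apply: IH; lia|]]].
(* For a rejecting final state this conclusion would be falsity. *)
have : concl_sem rho n n (cl_concl (reject_clause (ia_state A x0 w n 1))).
  apply: fire; rewrite ?n0 ?leqnn //; first by apply/In_array_formula; eauto 12.
  rewrite /= !minus_k0 eqxx; split=> //; split=> //; split=> //.
  by have := st n n; rewrite /grid_state subSn // subnn; apply; rewrite ?n0 ?leqnn.
by rewrite /=; case: ifP.
Qed.

End ArrayToHorn.

Lemma array_to_horn (Sigma : finType) (L : seq Sigma -> Prop) :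
  RealTime_IA L -> PredDioESOHorn L.
Proof.
move=> [A LA]; exists (array_formula A) => w; rewrite LA /ia_accepts.
case: w => [|x0 v]; first by split=> // -[].
split=> [acc|[wn mod]]; first by split=> //; apply: accepts_models acc.
exact: models_accepts mod.
Qed.

Theorem theorem2 (Sigma : finType) (L : seq Sigma -> Prop) :
  RealTime_IA L <-> PredDioESOHorn L.
Proof. by split; [exact: array_to_horn | exact: horn_to_array]. Qed.
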